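(* Let $R$ be a ring. Then: (i) $Nil^\ast(R)$ is the largest $\pi$-algebraic ideal of $R$; (ii) $Nil^\ast(R)$ is the largest integral quasi-regular ideal of $R$; (iii) $Nil^\ast(R)$ is the largest quasi-regular ideal of $R$ such that the quasi-inverse of each of its elements is a polynomial in this element. (In each case ''largest'' means that $Nil^\ast(R)$ is an ideal with the stated property and contains every ideal of $R$ with that property.)
   Context: Rings are associative, possibly nonunital and noncommutative; ''ideal'' means two-sided ideal. A ring is regarded as an algebra over $\mathbb{Z}$. The upper nilradical $Nil^\ast(R)$ is the largest nil ideal of $R$ (nil: every element is nilpotent). An element $a\in R$ is $\pi$-algebraic if there is $p\in\mathbb{Z}[x]$ with $p(0)=0$, $p(1)=1$, $p(a)=0$; it is integral if there is a monic $p\in\mathbb{Z}[x]$ with $p(0)=0$ and $p(a)=0$. With $a\circ b=a+b-ab$, an element $a\in R$ is quasi-regular if there is $a'\in R$ (its quasi-inverse) with $a\circ a'=a'\circ a=0$. An ideal is $\pi$-algebraic (resp. integral, quasi-regular) if each of its elements is. ''A polynomial in $a$'' means an element $P(a)$ with $P\in\mathbb{Z}[x]$; when $R$ is not unital, only polynomials with zero constant term can be evaluated at elements of $R$. *)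

(* Defs.v *)
From HB Require Import structures.
From mathcomp Require Import all_boot all_order all_algebra.
From mathcomp Require Import classical_sets.

Set Implicit Arguments.
Unset Strict Implicit.
Unset Printing Implicit Defensive.

Import GRing.Theory.

Local Open Scope classical_set_scope.
Local Open Scope ring_scope.

(* Associative rings, not assumed to be unital or commutative: MathComp's own
   ring structures all have a unit.  Multiplication is the semigroup law, in
   [group_scope]; the additive structure is in [ring_scope]. *)
HB.mixin Record Zmodule_Semigroup_isRng R of GRing.Zmodule R & Semigroup R := {
  rngMDl : forall a b c : R, ((a + b)%R * c)%g = (a * c)%g + (b * c)%g;
  rngMDr : forall a b c : R, (a * (b + c)%R)%g = (a * b)%g + (a * c)%g
}.

#[short(type="rngType")]
HB.structure Definition Rng :=
  { R of GRing.Zmodule R & Semigroup R & Zmodule_Semigroup_isRng R }.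

Section Definitions.
Variable R : rngType.
Implicit Types (a b e : R) (I N : set R) (p : {poly int}).

(* [powS a n] is a^(n+1); there is no zeroth power without a unit. *)
Definition powS a n : R := iter n (fun b => (a * b)%g) a.

(* The part of positive degree of p, evaluated at a.  This is p(a) whenever
   p(0) = 0. *)
Definition eval0 p a : R := \sum_(i < (size p).-1) powS a i *~ p`_i.+1.

Definition is_identity e : Prop := forall a, (e * a)%g = a /\ (a * e)%g = a.

(* b = p(a) for some p in Z[x]; a nonzero constant term is meaningful only when
   R has an identity element. *)
Definition polynomial_in a b : Prop :=
  exists p, (p.[0] = 0 /\ b = eval0 p a) \/
            (exists2 e, is_identity e & b = e *~ p.[0] + eval0 p a).

Definition nilpotent a : Prop := exists n, powS a n = 0.

Definition pi_algebraic a : Prop :=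
  exists p, [/\ p.[0] = 0, p.[1] = 1 & eval0 p a = 0].

Definition integral a : Prop :=
  exists p, [/\ p \is monic, p.[0] = 0 & eval0 p a = 0].

Definition circ a b : R := a + b - (a * b)%g.

Definition quasi_inverse a b : Prop := circ a b = 0 /\ circ b a = 0.

Definition quasi_regular a : Prop := exists b, quasi_inverse a b.

Record is_ideal I : Prop := IsIdeal {
  ideal0 : I 0;
  idealB : forall a b, I a -> I b -> I (a - b);
  idealMl : forall r a, I a -> I (r * a)%g;
  idealMr : forall r a, I a -> I (a * r)%g
}.

Definition nil_set I : Prop := forall a, I a -> nilpotent a.
Definition pi_algebraic_set I : Prop := forall a, I a -> pi_algebraic a.
Definition integral_set I : Prop := forall a, I a -> integral a.
Definition quasi_regular_set I : Prop := forall a, I a -> quasi_regular a.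

Definition polynomial_quasi_inverses I : Prop :=
  forall a b, I a -> quasi_inverse a b -> polynomial_in a b.

Definition largest_ideal (P : set R -> Prop) N : Prop :=
  [/\ is_ideal N, P N & forall I, is_ideal I -> P I -> I `<=` N].

(* Defined as the union of all nil ideals; [upper_nilradical_largest] below
   shows that it is itself a nil ideal, hence the largest one. *)
Definition upper_nilradical : set R :=
  \bigcup_(I in [set I | is_ideal I /\ nil_set I]) I.

End Definitions.

Arguments upper_nilradical : clear implicits.

Section UpperNilradical.
Variable R : rngType.
Implicit Types (a b x y : R) (I J : set R).

Let rng0M a : (0%R * a)%g = 0.
Proof. by apply: (addrI (0%R * a)%g); rewrite -rngMDl !addr0. Qed.

Let rngM0 a : (a * 0%R)%g = 0.
Proof. by apply: (addrI (a * 0%R)%g); rewrite -rngMDr !addr0. Qed.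

Let rngNM a b : ((- a)%R * b)%g = - (a * b)%g.
Proof. by apply: (addrI (a * b)%g); rewrite -rngMDl !subrr rng0M. Qed.

Let rngMN a b : (a * (- b)%R)%g = - (a * b)%g.
Proof. by apply: (addrI (a * b)%g); rewrite -rngMDr !subrr rngM0. Qed.

Lemma idealD I a b : is_ideal I -> I a -> I b -> I (a + b).
Proof.
move=> hI Ia Ib; rewrite -[b]opprK; apply: (idealB hI) => //.
by rewrite -[- b]add0r; apply: (idealB hI) => //; exact: ideal0.
Qed.

Lemma powSD a m n : (powS a m * powS a n)%g = powS a (m + n).+1.
Proof.
elim: m => [|m IH] //; rewrite addSn [in RHS]/powS iterS -/(powS a (m + n).+1).
by rewrite -IH mulgA.
Qed.

Lemma powS_powS a m n : exists k, powS (powS a m) n = powS a k.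
Proof.
elim: n => [|n [k IH]]; first by exists m.
exists (m + k).+1.
by rewrite /powS iterS -/(powS (powS a m) n) -/(powS a m) IH powSD.
Qed.

Lemma powS_addl J x y n : is_ideal J -> J y -> J (powS (x + y) n - powS x n).
Proof.
move=> hJ Jy; elim: n => [|n IH]; first by rewrite /powS /= addrC addKr.
rewrite /powS !iterS -/(powS (x + y) n) -/(powS x n).
have -> : ((x + y)%R * powS (x + y) n)%g - (x * powS x n)%g =
  ((x + y)%R * (powS (x + y) n - powS x n)%R)%g + (y * powS x n)%g.
  by rewrite rngMDr rngMN [in X in _ - X + _]rngMDl opprD addrA addrNK.
by apply: idealD => //; [apply: (idealMl hJ)|apply: (idealMr hJ)].
Qed.

Lemma upper_nilradical_largest : largest_ideal (@nil_set R) (upper_nilradical R).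
Proof.
have sub I : is_ideal I -> nil_set I -> I `<=` upper_nilradical R.
  by move=> hI nI a Ia; exists I.
split=> // [|a [I [_ nI]]]; last exact: nI.
split=> [|a b [I [hI nI] Ia] [J [hJ nJ] Jb]|r a [I [hI nI] Ia]
  |r a [I [hI nI] Ia]].
- apply: (sub [set 0]) => // [|a ->]; last by exists 0%N.
  split=> //= [a b -> ->|r a ->|r a ->]; by rewrite ?subrr ?rngM0 ?rng0M.
- apply: (sub [set z | exists x y, [/\ I x, J y & z = x + y]]).
  + split=> [|_ _ [x [y [Ix Jy ->]]] [x' [y' [Ix' Jy' ->]]]
      |r _ [x [y [Ix Jy ->]]]|r _ [x [y [Ix Jy ->]]]].
    * by exists 0, 0; split; [exact: ideal0|exact: ideal0|rewrite addr0].
    * exists (x - x'), (y - y'); split; [exact: idealB|exact: idealB|].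
      by rewrite opprD addrACA.
    * by exists (r * x)%g, (r * y)%g; rewrite -rngMDr; split=> //; exact: idealMl.
    * by exists (x * r)%g, (y * r)%g; rewrite -rngMDl; split=> //; exact: idealMr.
  + move=> _ [x [y [Ix Jy ->]]]; have [n xn0] := nI _ Ix.
    have := powS_addl x n hJ Jy; rewrite xn0 subr0 => /nJ[m].
    by have [k ->] := powS_powS (x + y) n m => ?; exists k.
  + exists a, (- b); split=> //; rewrite -sub0r.
    by apply: (idealB hJ) => //; exact: ideal0.
- by exists I => //; exact: idealMl.
- by exists I => //; exact: idealMr.
Qed.

End UpperNilradical.

(* Main.v *)
(* Nil elements satisfy X^n = 0 and have quasi-inverse -(a + a^2 + ...), which
   gives the easy half of all three parts.  Conversely, each of the properties
   (ii) and (iii) makes an ideal pi-algebraic: if b is the quasi-inverse of a,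
   so that (a - 1) b = a, then b = P(a) gives the polynomial X + P - X P (times
   X if P has a constant term), and a monic q of degree n killing b gives
   (X - 1)^n q(X / (X - 1)), whose value at 1 is the leading coefficient of q.

   It remains to see that a pi-algebraic ideal is nil.  If p kills a and has
   lowest term c X^m, then a^m u = c a^m for some polynomial u in a without
   constant term.  Applying the hypothesis to 3u shows that some positive
   integer d kills a power of a, and it remains to remove the prime factors of
   d one by one; for a prime q this is again the lowest term argument, now
   modulo q.  All of this happens in the image of Z[X] in the unital ring
   Z x R. *)
Require Import Defs.
From HB Require Import structures.
From mathcomp Require Import all_boot all_order all_algebra.
From mathcomp Require Import classical_sets.
From mathcomp Require Import ring zify.

Set Implicit Arguments.
Unset Strict Implicit.
Unset Printing Implicit Defensive.

Import Order.TTheory GRing.Theory Num.Theory.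

Local Open Scope ring_scope.

(** * Integer polynomials: remainders and lowest coefficients modulo an integer *)

Section IntPoly.
Implicit Types (p f : {poly int}) (c d e q : int).

Lemma poly_sub_horner p e : exists s, p = s * ('X - e%:P) + p.[e]%:P.
Proof.
have /factor_theorem[s def_s] : root (p - p.[e]%:P) e.
  by rewrite /root !hornerE subrr.
by exists s; rewrite -def_s subrK.
Qed.

Lemma dvdz_sub_horner p d e : (d - e %| p.[d] - p.[e])%Z.
Proof.
have [s def_p] := poly_sub_horner p e.
by rewrite [p in p.[d]]def_p !hornerE addrK dvdz_mull.
Qed.

(* For [q = 0] the coefficient [c] is just the lowest nonzero one. *)
Lemma lowest_coef_mod q p : ~~ (q %| p.[1])%Z -> exists m c r t,
  ~~ (q %| c)%Z /\ p = q%:P * r + 'X^m * (c%:P + 'X * t).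
Proof.
elim/poly_ind: p => [|p c IH]; first by rewrite horner0 dvdz0.
rewrite !hornerE => qp.
have [/dvdzP[k def_c]|qc] := boolP (q %| c)%Z; last first.
  by exists 0%N, c, 0, p; split=> //; rewrite expr0; ring.
have [|m [d [r [t [qd ->]]]]] := IH.
  by apply: contra qp => qp; rewrite def_c rpredD ?dvdz_mull.
exists m.+1, d, (r * 'X + k%:P), t; split=> //.
by rewrite def_c polyCM exprS; ring.
Qed.

End IntPoly.

(** * Polynomial identities for an element of a unital ring *)

Section PiAlgebraic.
Variable U : nzRingType.
Implicit Types (a b : U) (p f : {poly int}).

(** Integers commute with [a], so this is a ring morphism even for noncommutative [U]. *)
Definition int_eval a : {poly int} -> U := horner_morph (commr_int a).

HB.instance Definition _ a := GRing.RMorphism.on (int_eval a).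

Lemma int_evalX a : int_eval a 'X = a.
Proof. exact: horner_morphX. Qed.

Lemma int_evalC a c : int_eval a c%:P = c%:~R.
Proof. exact: horner_morphC. Qed.

Lemma int_eval_comp a f p : int_eval a (p \Po f) = int_eval (int_eval a f) p.
Proof.
elim/poly_ind: p => [|p c IH]; first by rewrite comp_poly0 !rmorph0.
by rewrite comp_poly_MXaddC !rmorphD !rmorphM /= IH !int_evalC int_evalX.
Qed.

Definition unital_pi_algebraic a : Prop :=
  exists p, [/\ p.[0] = 0, p.[1] = 1 & int_eval a p = 0].

(** What membership in a pi-algebraic ideal gives, phrased for a single element. *)
Definition strongly_pi_algebraic a : Prop :=
  forall f, f.[0] = 0 -> unital_pi_algebraic (int_eval a f).

Lemma strongly_pi_algebraic_eval a f : f.[0] = 0 ->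
  strongly_pi_algebraic a -> strongly_pi_algebraic (int_eval a f).
Proof.
move=> f0 pia g g0; rewrite -int_eval_comp; apply: pia.
by rewrite horner_comp f0.
Qed.

(** The value 1 at 1 is not divisible by the nonunit [q], so some coefficient is not either.
    Splitting off a factor [X] first makes the exponent positive and [r.[0] = 0]. *)
Lemma strongly_pi_algebraic_mod a (q : int) :
    strongly_pi_algebraic a -> ~~ (q %| 1)%Z ->
  exists m c r t, [/\ ~~ (q %| c)%Z, r.[0] = 0 &
    int_eval a (q%:P * r + 'X^(m.+1) * (c%:P + 'X * t)) = 0].
Proof.
move=> pia q1; have [|p [p0 p1 pa0]] := pia 'X; first by rewrite hornerX.
have [s def_p] := poly_sub_horner p 0; rewrite p0 polyC0 addr0 subr0 in def_p.
have [|m [c [r [t [qc def_s]]]]] := @lowest_coef_mod q s.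
  by move: p1; rewrite def_p !hornerE => ->.
exists m, c, (r * 'X), t; split=> //; first by rewrite hornerM hornerX mulr0.
rewrite int_evalX in pa0; rewrite -pa0 def_p def_s exprS; congr int_eval; ring.
Qed.

(* With [c] the lowest nonzero coefficient of a polynomial killing [a], some
   polynomial [v] in [a] acts on [a ^+ m] as the integer [3 c]; if [P] kills
   [v], then [P.[3 c]] kills [a ^+ m], and it is nonzero because it is [P.[1] = 1]
   modulo [3 c - 1], which is not a unit. *)
Lemma strongly_pi_algebraic_torsion a : strongly_pi_algebraic a ->
  exists d n, (0 < d)%N /\ (a *+ d) ^+ n = 0.
Proof.
move=> pia.
have [m [c [r [t [c_n0 _]]]]] :=
  strongly_pi_algebraic_mod pia (isT : ~~ (0 %| 1)%Z).
rewrite dvd0z in c_n0; rewrite polyC0 mul0r add0r => pa0.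
pose v : {poly int} := - (3%:P * 'X * t).
have [|P [P0 P1 Pv0]] := pia v; first by rewrite !hornerE /= ?(mulr0, mul0r) oppr0.
have [s def_P] := poly_sub_horner P (3 * c).
have Pn0 : P.[3 * c] != 0.
  apply/eqP=> P3c; have := dvdz_sub_horner P (3 * c) 1.
  rewrite P3c P1 sub0r dvdzE /= dvdn1.
  lia.
exists `|P.[3 * c]|%N, m.+1; split; first by rewrite absz_gt0.
have : int_eval a ('X^(m.+1) * P.[3 * c]%:P) = 0.
  (* Substitute [v] into [P = s (X - 3 c) + P(3 c)] and use [v - 3 c = -3 (c + X t)]. *)
  have -> : 'X^(m.+1) * P.[3 * c]%:P =
      'X^(m.+1) * (P \Po v) + 'X^(m.+1) * (c%:P + 'X * t) * (3%:P * (s \Po v)).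
    rewrite [P in P \Po v]def_P comp_polyD comp_polyM comp_polyB comp_polyX.
    by rewrite !comp_polyC polyCM /v; ring.
  rewrite rmorphD [X in X + _]rmorphM [X in _ + X]rmorphM /= pa0.
  by rewrite int_eval_comp Pv0 mulr0 mul0r addr0.
rewrite rmorphM rmorphXn /= int_evalX int_evalC => am0.
rewrite exprMn_n expnS mulrnA.
suff -> : a ^+ m.+1 *+ `|P.[3 * c]| = 0 by rewrite mul0rn.
move: am0; rewrite mulrzr; case: (P.[_]) => k //=.
by rewrite NegzE mulrNz => /eqP; rewrite oppr_eq0 => /eqP.
Qed.

(* The lowest coefficient of the annihilating polynomial prime to [q] yields
   [m], [v] and [w] with [a ^+ m * (1 - v) = q w] and [v], [w] polynomials in
   [a] without constant term.  Since [v] is killed by some [P] with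
   [P.[1] = 1], [a ^+ m] itself is a multiple of [q a]. *)
Lemma nilpotent_mulrn_prime a q n : prime q -> strongly_pi_algebraic a ->
  (a *+ q) ^+ n = 0 -> exists k, a ^+ k = 0.
Proof.
move=> q_pr pia qa0.
have q1 : ~~ (q%:Z %| 1)%Z by rewrite dvdzE /= dvdn1 neq_ltn prime_gt1 ?orbT.
have [m [c [r [t [qc r0 pa0]]]]] := strongly_pi_algebraic_mod pia q1.
have [k [l kc]] : exists k l : int, k * c = 1 + q%:Z * l.
  have /coprimezP[[u v] /= uv] : coprimez c q.
    rewrite coprimez_sym /coprimez /gcdz /= -[_ == _]/(coprime q `|c|).
    by rewrite prime_coprime.
  by exists u, (- v); rewrite -uv; ring.
pose v : {poly int} := - (k%:P * 'X * t).
have [|P [P0 P1 Pv0]] := pia v; first by rewrite !hornerE /= ?(mulr0, mul0r) oppr0.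
have [s def_P] := poly_sub_horner P 1; rewrite P1 in def_P.
have [r1 def_r] := poly_sub_horner r 0; rewrite r0 polyC0 addr0 subr0 in def_r.
pose w : {poly int} := - (k%:P * r1 + l%:P * 'X^m) * (s \Po v).
have am : a ^+ m.+1 = int_eval a ((q%:Z)%:P * 'X * w).
  have -> : a ^+ m.+1 = int_eval a ('X^(m.+1)) by rewrite rmorphXn /= int_evalX.
  apply/eqP; rewrite -subr_eq0 -rmorphB /=.
  (* Here [P(v) = 1 - (1 + k X t) s(v)]. Adding [k s(v)] times the annihilator cancels [k X t s(v)],
     and [k c = 1 + q l] leaves [X^(m+1)] plus multiples of [q X]. *)
  have -> : 'X^(m.+1) - (q%:Z)%:P * 'X * w =
      'X^(m.+1) * (P \Po v) +
      ((q%:Z)%:P * r + 'X^(m.+1) * (c%:P + 'X * t)) * (k%:P * (s \Po v)).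
    have kcP : k%:P * c%:P = 1 + (q%:Z)%:P * l%:P.
      by rewrite -polyCM kc polyCD polyCM.
    rewrite [P in P \Po v]def_P comp_polyD comp_polyM comp_polyB comp_polyX.
    rewrite !comp_polyC /w def_r exprS /v.
    ring: kcP.
  rewrite rmorphD [X in X + _]rmorphM [X in _ + X]rmorphM /= pa0.
  by rewrite int_eval_comp Pv0 mulr0 mul0r addr0.
exists (m.+1 * n)%N; rewrite exprM am -rmorphXn /= exprMn rmorphM rmorphXn /=.
by rewrite rmorphM /= int_evalC int_evalX -pmulrn mulr_natl qa0 mul0r.
Qed.

Lemma nilpotent_mulrn a d n : (0 < d)%N -> strongly_pi_algebraic a ->
  (a *+ d) ^+ n = 0 -> exists k, a ^+ k = 0.
Proof.
elim/ltn_ind: d a n => d IH a n d_gt0 pia.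
have [d1|d1] := leqP d 1.
  have -> : d = 1%N by lia.
  by exists n.
have q_pr := pdiv_prime d1; have [e def_d] := dvdnP (pdiv_dvd d).
have q_gt1 := prime_gt1 q_pr.
have e_gt0 : (0 < e)%N by move: d_gt0; rewrite {1}def_d muln_gt0 => /andP[].
(* With [d = e q], the prime case applies to [e a], and induction to [e < d]. *)
rewrite {1}def_d mulrnA => /(nilpotent_mulrn_prime q_pr)[|k aek0].
  have -> : a *+ e = int_eval a ('X *+ e) by rewrite rmorphMn /= int_evalX.
  by apply: strongly_pi_algebraic_eval; rewrite ?hornerMn ?hornerX ?mul0rn.
apply: (IH e _ a k) => //.
by rewrite [ltnRHS]def_d ltn_Pmulr.
Qed.

Lemma strongly_pi_algebraic_nilpotent a : strongly_pi_algebraic a ->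
  exists n, a ^+ n = 0.
Proof.
move=> pia; have [d [n [d_gt0 ad0]]] := strongly_pi_algebraic_torsion pia.
exact: nilpotent_mulrn ad0.
Qed.

(* If [n] is the degree of [q], then [p] is [(X - 1)^n * q (X / (X - 1))], and
   [b = a / (a - 1)]. *)
Lemma quasi_inverse_integral_pi_algebraic a b q :
    a + b - a * b = 0 -> a + b - b * a = 0 ->
    q \is monic -> q.[0] = 0 -> int_eval b q = 0 ->
  unital_pi_algebraic a.
Proof.
move=> ab ba mon_q q0 qb0; set n := (size q).-1.
have sz_q : size q = n.+1 by rewrite prednK // lt0n size_poly_eq0 monic_neq0.
exists (\sum_(i < n.+1) q`_i *: ('X^i * ('X - 1%:P) ^+ (n - i))); split.
- rewrite horner_sum big_ord_recl big1 => [|i _]; last first.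
    by rewrite hornerZ hornerM hornerXn lift0 exprS !mul0r mulr0.
  by rewrite /= -horner_coef0 q0 scale0r horner0 addr0.
- rewrite horner_sum big_ord_recr big1 => [|i _] /=; last first.
    by rewrite !hornerE subrr expr0n subn_eq0 leqNgt ltn_ord /= !mulr0.
  rewrite subnn expr0 mulr1 !hornerE expr1n mulr1.
  exact/eqP.
have comm_ab : a * b = b * a.
  by apply: oppr_inj; apply: (addrI (a + b)); rewrite ab ba.
have a1b : (a - 1) * b = a.
  by rewrite mulrBl mul1r; apply/eqP; rewrite -subr_eq0 -oppr_eq0 -ab; apply/eqP;
     rewrite !opprB addrA addrC addrA.
have comm_a1b : GRing.comm (a - 1) b.
  by rewrite /GRing.comm mulrBl mulrBr mul1r mulr1 comm_ab.
(* Termwise, [a = (a - 1) b] gives [a^i (a - 1)^(n - i) = (a - 1)^n b^i]. *)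
transitivity ((a - 1) ^+ n * int_eval b q); last by rewrite qb0 mulr0.
rewrite -[q in RHS]coefK poly_def sz_q !raddf_sum /= mulr_sumr.
apply: eq_bigr => i _; rewrite -!mul_polyC !rmorphM !rmorphXn rmorphB /=.
rewrite !int_evalC !int_evalX mulr1z -[in a ^+ i]a1b exprMn_comm //.
have comm_pow : (a - 1) ^+ (n - i) * b ^+ i = b ^+ i * (a - 1) ^+ (n - i).
  exact/commrX/commr_sym/commrX/commr_sym.
rewrite -mulrA -comm_pow [X in _ * X]mulrA -exprD subnKC; last by rewrite -ltnS.
rewrite !mulrA.
by rewrite (commr_int ((a - 1) ^+ n) q`_i).
Qed.

End PiAlgebraic.

(** * Zero, signs and integer multiples in a nonunital ring *)

Section Rng.
Variable R : rngType.
Implicit Types (a b c : R) (I : set R).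

Lemma rng_mul0r a : (0%R * a)%g = 0.
Proof. by apply: (addrI (0%R * a)%g); rewrite -rngMDl !addr0. Qed.

Lemma rng_mulr0 a : (a * 0%R)%g = 0.
Proof. by apply: (addrI (a * 0%R)%g); rewrite -rngMDr !addr0. Qed.

Lemma rng_mulrN a b : (a * (- b)%R)%g = - (a * b)%g.
Proof. by apply: (addrI (a * b)%g); rewrite -rngMDr !subrr rng_mulr0. Qed.

Lemma rng_mulNr a b : ((- a)%R * b)%g = - (a * b)%g.
Proof. by apply: (addrI (a * b)%g); rewrite -rngMDl !subrr rng_mul0r. Qed.

Lemma rng_mulzr a b (n : int) : (a * (b *~ n)%R)%g = (a * b)%g *~ n.
Proof.
have nat_case k : (a * (b *+ k)%R)%g = (a * b)%g *+ k.
  by elim: k => [|k IH]; rewrite ?rng_mulr0 // !mulrS rngMDr IH.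
by case: n => n; rewrite ?NegzE ?mulrNz ?rng_mulrN -!pmulrn nat_case.
Qed.

Lemma rng_mulzl a b (n : int) : ((a *~ n)%R * b)%g = (a * b)%g *~ n.
Proof.
have nat_case k : ((a *+ k)%R * b)%g = (a * b)%g *+ k.
  by elim: k => [|k IH]; rewrite ?rng_mul0r // !mulrS rngMDl IH.
by case: n => n; rewrite ?NegzE ?mulrNz ?rng_mulNr -!pmulrn nat_case.
Qed.

End Rng.

(* The Dorroh extension: [(m, a)] stands for [m + a]. *)
Definition dorroh (R : rngType) : Type := (int * R)%type.

(** * Ring structure on the extension by the integers *)

Section Dorroh.
Variable R : rngType.
Local Notation U := (dorroh R).
Implicit Types (a b : R) (x y z : U).

HB.instance Definition _ := GRing.Zmodule.copy U (int * R)%type.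

Definition dorroh_mul x y : U :=
  (x.1 * y.1, y.2 *~ x.1 + x.2 *~ y.1 + (x.2 * y.2)%g).

Lemma dorroh_mulA : associative dorroh_mul.
Proof.
move=> [k a] [l b] [m c]; rewrite /dorroh_mul /= mulrA; congr pair.
rewrite !rngMDl !rngMDr !rng_mulzl !rng_mulzr !mulrzDl mulgA.
rewrite -!mulrzA [l * k]mulrC [m * k]mulrC !addrA; congr (_ + _).
rewrite [LHS]addrAC; congr (_ + _); rewrite [RHS]addrAC; congr (_ + _).
exact: addrAC.
Qed.

Lemma dorroh_mul1l : left_id ((1, 0) : U) dorroh_mul.
Proof.
by move=> [k a]; rewrite /dorroh_mul /= mul1r mulr1z mul0rz rng_mul0r !addr0.
Qed.

Lemma dorroh_mul1r : right_id ((1, 0) : U) dorroh_mul.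
Proof.
move=> [k a]; rewrite /dorroh_mul /= mulr1 mulr1z mul0rz rng_mulr0.
by rewrite add0r addr0.
Qed.

Lemma dorroh_mulDl : left_distributive dorroh_mul +%R.
Proof.
move=> [k a] [l b] [m c]; rewrite /dorroh_mul /= mulrDl; congr pair => /=.
rewrite rngMDl mulrzDr mulrzDl [X in X + _ = _]addrACA; exact: addrACA.
Qed.

Lemma dorroh_mulDr : right_distributive dorroh_mul +%R.
Proof.
move=> [k a] [l b] [m c]; rewrite /dorroh_mul /= mulrDr; congr pair => /=.
rewrite rngMDr mulrzDr mulrzDl [X in X + _ = _]addrACA; exact: addrACA.
Qed.

Lemma dorroh_1_neq0 : ((1, 0) : U) != 0.
Proof. by []. Qed.

HB.instance Definition _ := GRing.Zmodule_isNzRing.Build U dorroh_mulA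
  dorroh_mul1l dorroh_mul1r dorroh_mulDl dorroh_mulDr dorroh_1_neq0.

Definition dorroh_inj a : U := (0, a).

Lemma dorroh_injD a b : dorroh_inj (a + b) = dorroh_inj a + dorroh_inj b.
Proof. by []. Qed.

Lemma dorroh_inj_mul a y :
  dorroh_inj a * y = dorroh_inj (a *~ y.1 + (a * y.2)%g).
Proof. by rewrite /GRing.mul /= /dorroh_mul /= mul0r mulr0z add0r. Qed.

Lemma dorroh_injM a b : dorroh_inj (a * b)%g = dorroh_inj a * dorroh_inj b.
Proof. by rewrite dorroh_inj_mul /= mulr0z add0r. Qed.

End Dorroh.

(** * Transfer between [R] and its Dorroh extension *)

Section Evaluation.
Variable R : rngType.
Implicit Types (a b e : R) (p f : {poly int}) (I : set R).

Lemma dorroh_inj_powS a n : dorroh_inj (powS a n) = dorroh_inj a ^+ n.+1.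
Proof.
elim: n => [|n IH]; first by rewrite expr1.
by rewrite exprS -IH -dorroh_injM.
Qed.

Lemma nilpotent_dorroh a n : dorroh_inj a ^+ n = 0 -> nilpotent a.
Proof.
move=> an0; exists n.
have : dorroh_inj (powS a n) = 0 by rewrite dorroh_inj_powS exprS an0 mulr0.
by case.
Qed.

Lemma dorroh_intr (k : int) : k%:~R = (k, 0) :> dorroh R.
Proof.
have natE n : n%:R = (n%:Z, 0) :> dorroh R.
  by elim: n => [|n IH] //; rewrite mulrS IH; congr pair; rewrite /= ?addr0.
case: k => n; first exact: natE.
by rewrite NegzE mulrNz -pmulrn natE; congr pair => /=; exact: oppr0.
Qed.

Lemma int_eval_dorroh_inj a p :
  int_eval (dorroh_inj a) p = (p.[0], eval0 p a) :> dorroh R.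
Proof.
have [->|p_neq0] := eqVneq p 0.
  by rewrite rmorph0 horner0 /eval0 size_poly0 big_ord0.
rewrite -[p in LHS]coefK poly_def raddf_sum /= horner_coef0 /eval0.
rewrite -[size p in LHS]prednK ?lt0n ?size_poly_eq0 // big_ord_recl.
rewrite expr0 alg_polyC int_evalC dorroh_intr.
have sumE n (F : 'I_n -> R) :
    \sum_i dorroh_inj (F i) = dorroh_inj (\sum_i F i).
  by elim/big_rec2: _ => // i y _ _ ->; rewrite dorroh_injD.
under eq_bigr => i _.
  rewrite lift0 -mul_polyC mulrC rmorphM rmorphXn /= int_evalX int_evalC.
  rewrite -dorroh_inj_powS dorroh_intr dorroh_inj_mul /= rng_mulr0 addr0.
  over.
by rewrite sumE; congr pair; rewrite /= ?addr0 ?add0r.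
Qed.

Lemma int_eval_eval0 a p : p.[0] = 0 ->
  int_eval (dorroh_inj a) p = dorroh_inj (eval0 p a).
Proof. by move=> p0; rewrite int_eval_dorroh_inj p0. Qed.

Lemma pi_algebraic_dorroh a :
  pi_algebraic a <-> unital_pi_algebraic (dorroh_inj a).
Proof.
by split=> -[p [p0 p1]]; rewrite ?int_eval_eval0 // => pa;
  exists p; rewrite ?int_eval_eval0 ?pa //; split=> //; case: pa.
Qed.

Lemma circ_dorroh a b : dorroh_inj (circ a b) =
  dorroh_inj a + dorroh_inj b - dorroh_inj a * dorroh_inj b.
Proof. by rewrite -dorroh_injM. Qed.

(** In the Dorroh extension, [1 - b] is a left inverse and [1 - c] a right inverse of [1 - a]. *)
Lemma quasi_inverse_uniq a b c :
  quasi_inverse a b -> quasi_inverse a c -> b = c.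
Proof.
move=> [_ ba] [ac _].
have circ_unit (x y : R) : circ x y = 0 -> (1 - dorroh_inj x) * (1 - dorroh_inj y) = 1.
  move=> xy; have := circ_dorroh x y; rewrite xy => xy0.
  rewrite mulrBl mul1r mulrBr mulr1 -addrA -opprD.
  rewrite [X in 1 - X]addrCA [X in 1 - X]addrA.
  by rewrite -xy0 subr0.
suff : dorroh_inj b = dorroh_inj c by case.
apply/oppr_inj/(addrI 1); rewrite -[LHS]mulr1 -[X in _ * X = _](circ_unit _ _ ac).
by rewrite mulrA circ_unit ?mul1r.
Qed.

Lemma eval0_quasi_inverse a p : p.[0] = 0 ->
    int_eval (dorroh_inj a) ('X + p - 'X * p) = 0 ->
  quasi_inverse a (eval0 p a).
Proof.
move=> p0 pa0; have inj0 (z : R) : dorroh_inj z = 0 -> z = 0 by case.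
have comm_ap : dorroh_inj a * dorroh_inj (eval0 p a) =
    dorroh_inj (eval0 p a) * dorroh_inj a.
  rewrite -int_eval_eval0 // -{1 4}[dorroh_inj a]int_evalX.
  by rewrite -!rmorphM mulrC.
rewrite rmorphB rmorphD rmorphM /= int_evalX int_eval_eval0 // in pa0.
split; apply: inj0; rewrite circ_dorroh //.
by rewrite -comm_ap [X in X - _]addrC.
Qed.

Lemma nilpotent_quasi_inverse a : nilpotent a ->
  exists2 p, p.[0] = 0 & quasi_inverse a (eval0 p a).
Proof.
(* A geometric sum up to [X^(n+1)], since [powS a n] is [a^(n+1)]; [X + p - X p] telescopes. *)
move=> [n an0]; pose p : {poly int} := - (\sum_(i < n.+1) 'X^i) * 'X.
have p0 : p.[0] = 0 by rewrite hornerM hornerX mulr0.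
exists p => //; apply: eval0_quasi_inverse => //.
have -> : 'X + p - 'X * p = 'X^(n.+1) * 'X.
  have := subrX1 ('X : {poly int}) n.+1; rewrite /p.
  set s := \sum_(i < _) _ => def_s.
  by rewrite -[X in _ = X * _](subrK 1) def_s; ring.
by rewrite rmorphM rmorphXn /= int_evalX -dorroh_inj_powS an0 mul0r.
Qed.

Lemma nilpotent_annihilator a : nilpotent a ->
  exists n, eval0 'X^(n.+1) a = 0.
Proof.
move=> [n an0]; exists n.
have : int_eval (dorroh_inj a) 'X^(n.+1) = 0.
  by rewrite rmorphXn /= int_evalX -dorroh_inj_powS an0.
by rewrite int_eval_eval0 => [[]|] //; rewrite hornerXn expr0n.
Qed.

Lemma ideal_eval0 I a p : is_ideal I -> I a -> I (eval0 p a).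
Proof.
move=> hI Ia; have I0 := ideal0 hI.
have I_nat b n : I b -> I (b *+ n).
  by move=> Ib; elim: n => [|n IH] //; rewrite mulrS; exact: idealD.
rewrite /eval0; elim/big_ind: _ => // [x y Ix Iy|i _]; first exact: idealD.
have Iai : I (powS a i).
  by case: (nat_of_ord i) => [//|n]; exact: (Defs.idealMr hI).
case: (p`_i.+1) => n; first exact: I_nat.
by rewrite NegzE mulrNz -[X in I X]sub0r; apply: (idealB hI) => //; exact: I_nat.
Qed.

(** The ideal contains every polynomial in [a] without constant term, so [a] is strongly
    pi-algebraic. *)
Lemma pi_algebraic_ideal_nil I :
  is_ideal I -> pi_algebraic_set I -> nil_set I.
Proof.
move=> hI piI a Ia.
have [f f0|n] := @strongly_pi_algebraic_nilpotent _ (dorroh_inj a).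
  rewrite int_eval_eval0 //; apply/pi_algebraic_dorroh/piI.
  exact: ideal_eval0.
exact: nilpotent_dorroh.
Qed.

Lemma integral_quasi_inverse_pi_algebraic a b :
  quasi_inverse a b -> integral b -> pi_algebraic a.
Proof.
move=> [ab ba] [q [mon_q q0 qb]]; apply/pi_algebraic_dorroh.
apply: (@quasi_inverse_integral_pi_algebraic _ _ (dorroh_inj b) q) => //.
- by rewrite -circ_dorroh ab.
- by rewrite [X in X - _]addrC -circ_dorroh ba.
- by rewrite int_eval_eval0 // qb.
Qed.

Lemma polynomial_quasi_inverse_pi_algebraic a b :
  quasi_inverse a b -> polynomial_in a b -> pi_algebraic a.
Proof.
move=> [ab _] [p def_b]; apply/pi_algebraic_dorroh.
(* The factor ['X] absorbs the constant term of [p]. *)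
exists ('X * ('X + p - 'X * p)); split.
- by rewrite hornerM hornerX mul0r.
- by rewrite !hornerE; ring.
(* An identity of [R] is not the unit of the extension, so [b] and [p(a)] may differ there;
   multiplying by [a] removes the difference. *)
have ab_ev : dorroh_inj a * dorroh_inj b =
    dorroh_inj a * int_eval (dorroh_inj a) p.
  rewrite int_eval_dorroh_inj !dorroh_inj_mul /= mulr0z add0r; congr dorroh_inj.
  case: def_b => [[-> ->]|[e e1 ->]]; first by rewrite mulr0z add0r.
  by rewrite rngMDr rng_mulzr (e1 a).2.
rewrite rmorphM rmorphB rmorphD rmorphM /= int_evalX mulrBr mulrDr.
by rewrite -ab_ev -mulrDr -mulrBr -circ_dorroh ab mulr0.
Qed.

End Evaluation.

(** * The three characterizations of the upper nilradical *)

Theorem corollary3p13 (R : rngType) :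
  [/\ largest_ideal (@pi_algebraic_set R) (upper_nilradical R),
      largest_ideal (fun I : set R => integral_set I /\ quasi_regular_set I)
        (upper_nilradical R) &
      largest_ideal
        (fun I : set R => quasi_regular_set I /\ polynomial_quasi_inverses I)
        (upper_nilradical R)].
Proof.
have [idealN nilN maxN] := upper_nilradical_largest R.
have qrN : quasi_regular_set (upper_nilradical R).
  by move=> a /nilN/nilpotent_quasi_inverse[p _ ?]; exists (eval0 p a).
split; split=> //.
- move=> a /nilN/nilpotent_annihilator[n an0].
  by exists 'X^(n.+1); rewrite !hornerXn expr0n expr1n.
- by move=> I hI /(pi_algebraic_ideal_nil hI); exact: maxN.
- split=> // a /nilN/nilpotent_annihilator[n an0].
  by exists 'X^(n.+1); rewrite monicXn hornerXn expr0n.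
- move=> I hI [intI qrI]; apply: maxN => //; apply: pi_algebraic_ideal_nil => //.
  move=> a Ia; have [b ab] := qrI a Ia.
  apply: (integral_quasi_inverse_pi_algebraic ab); apply: intI.
  (* This puts the quasi-inverse in [I], where integrality is available. *)
  have -> : b = (a * b)%g - a.
    apply/eqP; rewrite -subr_eq0 opprB addrCA addrA; apply/eqP; exact: ab.1.
  by apply: (idealB hI) => //; exact: (Defs.idealMr hI).
(* The given [b] is arbitrary, so uniqueness identifies it with the geometric sum. *)
- split=> // a b /nilN/nilpotent_quasi_inverse[p p0 pa] ab.
  by exists p; left; split=> //; exact: quasi_inverse_uniq ab pa.
- move=> I hI [qrI polyI]; apply: maxN => //; apply: pi_algebraic_ideal_nil => //.
  move=> a Ia; have [b ab] := qrI a Ia.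
  exact: (polynomial_quasi_inverse_pi_algebraic ab (polyI _ _ Ia ab)).
Qed.
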